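(* Let $X$ and $Y$ be complex Banach spaces, and let $A\in\mathcal{L}(X,Y)$ and $B,C\in\mathcal{L}(Y,X)$ satisfy $$A(BA)^2=ABACA=ACABA=(AC)^2A.$$ Then, for every $i$ with $1\leq i\leq 19$, $$\sigma_{R_i}(AC)\setminus\{0\}=\sigma_{R_i}(BA)\setminus\{0\}.$$
   Context: $\mathcal{L}(X,Y)$ is the set of bounded linear operators from the complex Banach space $X$ to the complex Banach space $Y$, and $\mathcal{L}(X)=\mathcal{L}(X,X)$. Here $AC\in\mathcal{L}(Y)$ and $BA\in\mathcal{L}(X)$. $\mathbb{Z}_+$ is the set of nonnegative integers. For $T\in\mathcal{L}(Z)$, $Z$ a complex Banach space, $\mathcal{N}(T)$ and $\mathcal{R}(T)$ denote the kernel and the range of $T$, $T^0=I$, and dimensions are allowed to be $\infty$. For $n\in\mathbb{Z}_+$ put $$c_n(T)=\dim \mathcal{R}(T^n)/\mathcal{R}(T^{n+1}),\qquad c_n'(T)=\dim \mathcal{N}(T^{n+1})/\mathcal{N}(T^n),$$ and let $k_n(T)$ be the dimension of the kernel of the linear map $\mathcal{R}(T^n)/\mathcal{R}(T^{n+1})\to\mathcal{R}(T^{n+1})/\mathcal{R}(T^{n+2})$ induced by $T$. Put $c(T)=\sum_{n=0}^\infty c_n(T)$, $c'(T)=\sum_{n=0}^\infty c_n'(T)$, $k(T)=\sum_{n=0}^\infty k_n(T)$. For each complex Banach space $Z$, define the following subsets of $\mathcal{L}(Z)$ by giving the condition for $T\in\mathcal{L}(Z)$ to belong to them: - $R_1$: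 $c(T)=0$. - $R_2$: $c(T)<\infty$. - $R_3$: there exists $d\in\mathbb{Z}_+$ such that $c_d(T)=0$ and $\mathcal{R}(T^{d+1})$ is closed. - $R_4$: $c_n(T)<\infty$ for all $n\in\mathbb{Z}_+$. - $R_5$: there exists $d\in\mathbb{Z}_+$ such that $c_d(T)<\infty$ and $\mathcal{R}(T^{d+1})$ is closed. - $R_6$: $c'(T)=0$ and $\mathcal{R}(T)$ is closed. - $R_7$: $c'(T)<\infty$ and $\mathcal{R}(T)$ is closed. - $R_8$: there exists $d\in\mathbb{Z}_+$ such that $c_d'(T)=0$ and $\mathcal{R}(T^{d+1})$ is closed. - $R_9$: $c_n'(T)<\infty$ for every $n\in\mathbb{Z}_+$ and $\mathcal{R}(T)$ is closed. - $R_{10}$: there exists $d\in\mathbb{Z}_+$ such that $c_d'(T)<\infty$ and $\mathcal{R}(T^{d+1})$ is closed. - $R_{11}$: $k(T)=0$ and $\mathcal{R}(T)$ is closed. - $R_{12}$: $k(T)<\infty$ and $\mathcal{R}(T)$ is closed. - $R_{13}$: there exists $d\in\mathbb{Z}_+$ such that $k_n(T)=0$ for every $n\geq d$ and $\mathcal{R}(T^{d+1})$ is closed. - $R_{14}$: $k_n(T)<\infty$ for every $n\in\mathbb{Z}_+$ and $\mathcal{R}(T)$ is closed. - $R_{15}$: there exists $d\in\mathbb{Z}_+$ such that $k_n(T)<\infty$ for every $n\geq d$ and $\mathcal{R}(T^{d+1})$ is closed. - $R_{16}$: there exists $d\in\mathbb{Z}_+$ such that $c_d(T)=0$ and $\mathcal{R}(T)+\mathcal{N}(T^d)$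 is closed. - $R_{17}$: there exists $d\in\mathbb{Z}_+$ such that $c_d(T)<\infty$ and $\mathcal{R}(T)+\mathcal{N}(T^d)$ is closed. - $R_{18}$: there exists $d\in\mathbb{Z}_+$ such that $k_n(T)=0$ for every $n\geq d$ and $\mathcal{R}(T)+\mathcal{N}(T^d)$ is closed. - $R_{19}$: there exists $d\in\mathbb{Z}_+$ such that $k_n(T)<\infty$ for every $n\geq d$ and $\mathcal{R}(T)+\mathcal{N}(T^d)$ is closed. The corresponding spectrum of $T\in\mathcal{L}(Z)$ is $\sigma_{R_i}(T)=\{\lambda\in\mathbb{C} : T-\lambda I\notin R_i\}$. *)

(* Defs.v *)
From HB Require Import structures.
From mathcomp Require Import all_boot all_order all_algebra.
From mathcomp Require Import generic_quotient ring_quotient.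
From mathcomp Require Import all_classical all_reals all_analysis.
From mathcomp Require Import complex.

Set Implicit Arguments.
Unset Strict Implicit.
Unset Printing Implicit Defensive.

Import Order.TTheory GRing.Theory Num.Theory.
Import numFieldNormedType.Exports.

Local Open Scope classical_set_scope.
Local Open Scope quotient_scope.
Local Open Scope complex_scope.
Local Open Scope ring_scope.

Section LinearAlgebra.
Variable K : fieldType.

(* submodClosed does not inherit from zmodClosed, which the library quotient   *)
(* expects.                                                                   *)
Definition subzmod (Z : lmodType K) (V : submodClosed Z) : {pred Z} :=
  fun x => x \in V.

Lemma subzmod_closed (Z : lmodType K) (V : submodClosed Z) :
  zmod_closed (subzmod V).
Proof.
split=> [|x y Vx Vy]; first exact: (@rpred0 _ V).
by apply: (@rpredD _ V) => //; rewrite -scaleN1r; apply: rpredZ.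
Qed.

HB.instance Definition _ (Z : lmodType K) (V : submodClosed Z) :=
  GRing.isZmodClosed.Build Z (subzmod V) (subzmod_closed V).

(* The Zmodule quotient of the library, to be given its scalar action. *)
Definition lquot (Z : lmodType K) (V : submodClosed Z) : Type :=
  Quotient.quot (subzmod V).

Section Lquot.
Variables (Z : lmodType K) (V : submodClosed Z).

HB.instance Definition _ := GRing.Zmodule.on (lquot V).
HB.instance Definition _ :=
  EqQuotient.copy (lquot V) (Quotient.quot (subzmod V)).

Definition lquot_pi (x : Z) : lquot V := \pi_(Quotient.quot (subzmod V)) x.
Definition lquot_scale (a : K) (q : lquot V) : lquot V :=
  lquot_pi (a *: repr q).

Lemma lquot_piP x y : lquot_pi x = lquot_pi y <-> x - y \in V.
Proof.
rewrite -[x - y \in V]/(x - y \in subzmod V) Quotient.idealrBE.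
by split=> [/eqP|/eqP].
Qed.

Lemma lquot_repr (q : lquot V) : lquot_pi (repr q) = q.
Proof. exact: (@reprK Z (Quotient.quot (subzmod V))). Qed.

Lemma lquot_piD x y : lquot_pi (x + y) = lquot_pi x + lquot_pi y.
Proof. exact: (@Quotient.pi_add Z (subzmod V)). Qed.

Lemma lquot_piZ a x : lquot_pi (a *: x) = lquot_scale a (lquot_pi x).
Proof.
apply/lquot_piP; rewrite -scalerBr rpredZ//.
by apply/lquot_piP; rewrite lquot_repr.
Qed.

Lemma lquot_scaleA a b q :
  lquot_scale a (lquot_scale b q) = lquot_scale (a * b) q.
Proof. by rewrite -(lquot_repr q) -!lquot_piZ scalerA. Qed.

Lemma lquot_scale1 : left_id 1 lquot_scale.
Proof. by move=> q; rewrite -(lquot_repr q) -lquot_piZ scale1r. Qed.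

Lemma lquot_scaleDr : right_distributive lquot_scale +%R.
Proof.
move=> a p q; rewrite -(lquot_repr p) -(lquot_repr q).
by rewrite -lquot_piD -!lquot_piZ scalerDr lquot_piD.
Qed.

Lemma lquot_scaleDl q : {morph lquot_scale^~ q : a b / a + b}.
Proof.
by move=> a b /=; rewrite -(lquot_repr q) -!lquot_piZ scalerDl lquot_piD.
Qed.

HB.instance Definition _ := GRing.Zmodule_isLmodule.Build K (lquot V)
  lquot_scaleA lquot_scale1 lquot_scaleDr lquot_scaleDl.

Lemma lquot_pi_linear : linear lquot_pi.
Proof. by move=> a x y; rewrite lquot_piD lquot_piZ. Qed.

HB.instance Definition _ :=
  GRing.isLinear.Build K Z (lquot V) *:%R lquot_pi lquot_pi_linear.

End Lquot.

(* U/V, for a subspace U of Z containing V, as a subspace of Z/V. *)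
Definition subquot (Z : lmodType K) (U : set Z) (V : submodClosed Z) :
  set (lquot V) := [set lquot_pi V x | x in U].

(* The map Z/V -> Z/W induced by T; see induced_pi. *)
Definition induced (Z : lmodType K) (V W : submodClosed Z)
    (T : {linear Z -> Z}) (q : lquot V) : lquot W :=
  lquot_pi W (T (repr q)).

Lemma induced_pi (Z : lmodType K) (V W : submodClosed Z)
    (T : {linear Z -> Z}) : (forall x, x \in V -> T x \in W) ->
  forall x, induced W T (lquot_pi V x) = lquot_pi W (T x).
Proof.
move=> TVW x; apply/lquot_piP; rewrite -linearB; apply: TVW.
by apply/lquot_piP; rewrite lquot_repr.
Qed.

Section RangeKernel.
Variables (Z1 Z2 : lmodType K) (T : {linear Z1 -> Z2}).

Definition rangep : {pred Z2} := fun y => `[< range T y >].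
Definition kerp : {pred Z1} := fun x => T x == 0.

Lemma rangep_submod : submod_closed rangep.
Proof.
split; first by apply/asboolP; exists 0; rewrite ?linear0.
move=> a _ _ /asboolP[x _ <-] /asboolP[y _ <-].
by apply/asboolP; exists (a *: x + y); rewrite ?linearP.
Qed.

Lemma kerp_submod : submod_closed kerp.
Proof.
split=> [|a x y /eqP Tx0 /eqP Ty0]; apply/eqP; first exact: linear0.
by rewrite linearP Tx0 Ty0 scaler0 addr0.
Qed.

HB.instance Definition _ := GRing.isSubmodClosed.Build K Z2 rangep rangep_submod.
HB.instance Definition _ := GRing.isSubmodClosed.Build K Z1 kerp kerp_submod.

End RangeKernel.

Section Powers.
Variables (Z : lmodType K) (T : {linear Z -> Z}) (n : nat).

Definition oppow : Z -> Z := iter n T.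

Lemma oppow_linear : linear oppow.
Proof.
by rewrite /oppow; elim: n => [//|m IH] a x y; rewrite !iterS IH linearP.
Qed.

HB.instance Definition _ := GRing.isLinear.Build K Z Z *:%R oppow oppow_linear.

End Powers.

(* The hypothesis of induced_pi for V = R(T^n) and W = R(T^n.+1). *)
Lemma rangep_oppowS (Z : lmodType K) (T : {linear Z -> Z}) (n : nat) (x : Z) :
  x \in rangep (oppow T n) -> T x \in rangep (oppow T n.+1).
Proof.
by move=> /asboolP[y _ <-]; apply/asboolP; exists y; rewrite // /oppow iterS.
Qed.

Definition is_basis (Z : lmodType K) (S : set Z) (n : nat) (e : 'I_n -> Z) :=
  [/\ forall i, S (e i),
      forall a : 'I_n -> K, \sum_i a i *: e i = 0 -> forall i, a i = 0 &
      forall x, S x -> exists a : 'I_n -> K, x = \sum_i a i *: e i].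

(* The dimension of a subspace S: all its finite bases have the same number  *)
(* of elements, and the infimum of the empty set is +oo.                      *)
Definition vdim (R : realType) (Z : lmodType K) (S : set Z) : \bar R :=
  ereal_inf [set (n%:R)%:E | n in [set n | exists e : 'I_n -> Z, is_basis S e]].

End LinearAlgebra.

Arguments lquot_pi [K Z] V x.
Arguments subquot [K Z] U V _.
Arguments induced [K Z V] W T q.

Section Regularities.
Variables (R : realType) (Z : completeNormedModType R[i]).
Implicit Types T : {linear Z -> Z}.

Definition c_ T (n : nat) : \bar R :=
  vdim R (subquot (range (oppow T n)) (rangep (oppow T n.+1))).

Definition c'_ T (n : nat) : \bar R :=
  vdim R (subquot (kerp (oppow T n.+1) : set Z) (kerp (oppow T n))).

(* The dimension of the kernel of the restriction to R(T^n)/R(T^n.+1) of the    *)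
(* map Z/R(T^n.+1) -> Z/R(T^n.+2) induced by T; by linearity of T, it sends    *)
(* R(T^n)/R(T^n.+1) into R(T^n.+1)/R(T^n.+2).                                  *)
Definition k_ T (n : nat) : \bar R :=
  vdim R [set q | subquot (range (oppow T n)) (rangep (oppow T n.+1)) q /\
                  induced (rangep (oppow T n.+2)) T q = 0].

Definition c_sum T : \bar R := (\sum_(0 <= n <oo) c_ T n)%E.
Definition c'_sum T : \bar R := (\sum_(0 <= n <oo) c'_ T n)%E.
Definition k_sum T : \bar R := (\sum_(0 <= n <oo) k_ T n)%E.

Definition range_plus_ker_closed T (d : nat) : Prop :=
  closed [set z | exists x y, [/\ range T x, kerp (oppow T d) y & z = x + y]].

Definition regularity (i : nat) T : Prop :=
  match i with
  | 1 => c_sum T = 0%E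
  | 2 => (c_sum T < +oo)%E
  | 3 => exists d, c_ T d = 0%E /\ closed (range (oppow T d.+1))
  | 4 => forall n, (c_ T n < +oo)%E
  | 5 => exists d, (c_ T d < +oo)%E /\ closed (range (oppow T d.+1))
  | 6 => c'_sum T = 0%E /\ closed (range T)
  | 7 => (c'_sum T < +oo)%E /\ closed (range T)
  | 8 => exists d, c'_ T d = 0%E /\ closed (range (oppow T d.+1))
  | 9 => (forall n, (c'_ T n < +oo)%E) /\ closed (range T)
  | 10 => exists d, (c'_ T d < +oo)%E /\ closed (range (oppow T d.+1))
  | 11 => k_sum T = 0%E /\ closed (range T)
  | 12 => (k_sum T < +oo)%E /\ closed (range T)
  | 13 => exists d, (forall n, (d <= n)%N -> k_ T n = 0%E) /\
                    closed (range (oppow T d.+1))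
  | 14 => (forall n, (k_ T n < +oo)%E) /\ closed (range T)
  | 15 => exists d, (forall n, (d <= n)%N -> (k_ T n < +oo)%E) /\
                    closed (range (oppow T d.+1))
  | 16 => exists d, c_ T d = 0%E /\ range_plus_ker_closed T d
  | 17 => exists d, (c_ T d < +oo)%E /\ range_plus_ker_closed T d
  | 18 => exists d, (forall n, (d <= n)%N -> k_ T n = 0%E) /\
                    range_plus_ker_closed T d
  | 19 => exists d, (forall n, (d <= n)%N -> (k_ T n < +oo)%E) /\
                    range_plus_ker_closed T d
  | _ => False
  end.

Definition spectrum (i : nat) T : set R[i] :=
  [set lambda : R[i] | ~ regularity i (T \- lambda \*: idfun)].

End Regularities.

Definition bounded_operator (K : numFieldType) (X Y : normedModType K)
    (f : {linear X -> Y}) : Prop :=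
  exists M : K, forall x, `|f x| <= M * `|x|.

(* Main.v *)
From HB Require Import structures.
Require Import Defs.
From mathcomp Require Import all_boot all_order all_algebra.
From mathcomp Require Import all_classical all_reals all_analysis.
From mathcomp Require Import complex.
Import Order.TTheory GRing.Theory Num.Theory.
Import numFieldNormedType.Exports.
Local Open Scope classical_set_scope.
Local Open Scope complex_scope.
Local Open Scope ring_scope.

(** Write [P] for BA on X and [Q] for AC on Y.  The hypothesis provides
    intertwiners in both directions: u = ABA from X to Y and v = BACAC from Y
    to X satisfy uP = Qu and vQ = Pv, and moreover vu = P^4 and uv = Q^4.

    Fix a nonzero scalar l and put T = P - l, S = Q - l.  Then u and v also
    intertwine T and S.  Since P^4 - l^4 = T g(P) for a polynomial g,
    vu = l^4 + T g with g commuting with T, and likewise uv = l^4 + S h.  This,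
    recorded in [linkage], and the continuity of u and v are all that is used
    of A, B and C.

    A linkage makes each of the algebraic invariants of T and S agree: on
    R(T^n)/R(T^(n+1)) and on N(T^(n+1))/N(T^n) the operator T g induces 0, so
    vu acts there as the nonzero scalar l^4, and u and v induce isomorphisms
    ([linkage_c], [linkage_c'], [linkage_k]; the common core is
    [vdim_subquot_eq]).

    For the topological conditions, the point is that R(T^n) and
    R(T) + N(T^d) are the full preimages under u of R(S^n) and R(S) + N(S^d)
    ([range_preimage], [range_plus_ker_preimage]).  As u is continuous,
    closedness passes from S to T.  The situation being symmetric in T and S,
    each of the regularities holds for T exactly when it holds for S. *)

Set Implicit Arguments.
Unset Strict Implicit.

(** * Dimensions of quotients of subspaces *)

Section Dimension.
Variable K : fieldType.

(** The maps are plain functions with a linearity hypothesis, because those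
    induced on quotients are linear only under a condition on the subspaces. *)
Lemma is_basis_transfer (W1 W2 : lmodType K) (S1 : set W1) (S2 : set W2)
    (f : W1 -> W2) (g : W2 -> W1) (a : K) (n : nat) (e : 'I_n -> W1) :
  linear f -> linear g -> a != 0 ->
  (forall x, S1 x -> S2 (f x)) -> (forall y, S2 y -> S1 (g y)) ->
  (forall x, S1 x -> g (f x) = a *: x) ->
  (forall y, S2 y -> f (g y) = a *: y) ->
  is_basis S1 e -> is_basis S2 (f \o e).
Proof.
move=> f_lin g_lin a0 fS gS gf fg [eS e_free e_span].
have fsum b : f (\sum_i b i *: e i) = \sum_i b i *: f (e i).
  pose F : {linear W1 -> W2} :=
    HB.pack f (GRing.isLinear.Build K W1 W2 *:%R f f_lin).
  rewrite -[f]/(F : W1 -> W2) linear_sum; apply: eq_bigr => i _.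
  by rewrite linearZ.
have gsum b : g (\sum_i b i *: f (e i)) = \sum_i b i *: g (f (e i)).
  pose G : {linear W2 -> W1} :=
    HB.pack g (GRing.isLinear.Build K W2 W1 *:%R g g_lin).
  rewrite -[g]/(G : W2 -> W1) linear_sum; apply: eq_bigr => i _.
  by rewrite linearZ.
split=> [i|b sum0 i|y Sy].
- exact: fS.
- have : \sum_j (a * b j) *: e j = 0.
    transitivity (g (\sum_j b j *: f (e j))).
      rewrite gsum; apply: eq_bigr => j _.
      by rewrite gf// scalerA mulrC.
    (* g 0 = 0, obtained from g (1 *: 0 + 0) = 1 *: g 0 + g 0. *)
    rewrite sum0 -[LHS](addrK (g 0)) -[X in X + _ - _](scale1r (g 0)).
    by rewrite -g_lin scaler0 addr0 subrr.
  by move=> /e_free/(_ i)/eqP; rewrite mulf_eq0 (negPf a0) => /eqP.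
- have [b gy] := e_span _ (gS _ Sy).
  exists (fun i => a^-1 * b i).
  rewrite -[LHS]scale1r -(mulVf a0) -scalerA -fg// gy fsum scaler_sumr.
  by apply: eq_bigr => i _; rewrite scalerA.
Qed.

Definition lquot_map (Z1 Z2 : lmodType K) (V1 : submodClosed Z1)
    (V2 : submodClosed Z2) (f : Z1 -> Z2) (q : lquot V1) : lquot V2 :=
  lquot_pi V2 (f (repr q)).

Lemma lquot_map_pi (Z1 Z2 : lmodType K) (V1 : submodClosed Z1)
    (V2 : submodClosed Z2) (f : {linear Z1 -> Z2}) :
  (forall x, x \in V1 -> f x \in V2) ->
  forall x, lquot_map V2 f (lquot_pi V1 x) = lquot_pi V2 (f x).
Proof.
move=> fV x; apply/lquot_piP; rewrite -linearB; apply: fV.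
by apply/lquot_piP; rewrite lquot_repr.
Qed.

Lemma lquot_map_linear (Z1 Z2 : lmodType K) (V1 : submodClosed Z1)
    (V2 : submodClosed Z2) (f : {linear Z1 -> Z2}) :
  (forall x, x \in V1 -> f x \in V2) -> linear (@lquot_map _ _ V1 V2 f).
Proof.
move=> fV a p q; rewrite -(lquot_repr p) -(lquot_repr q) -linearP.
by rewrite !lquot_map_pi// !linearP.
Qed.

(** If the maps induced by [u] and [v] between (D1 + V1)/V1 and (D2 + V2)/V2
    compose on both sides to the nonzero scalar [a], then u and v / a are
    mutually inverse isomorphisms. *)
Lemma vdim_subquot_eq (R : realType) (Z1 Z2 : lmodType K) (D1 : set Z1)
    (D2 : set Z2) (V1 : submodClosed Z1) (V2 : submodClosed Z2)
    (u : {linear Z1 -> Z2}) (v : {linear Z2 -> Z1}) (a : K) :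
  a != 0 ->
  (forall x, D1 x -> D2 (u x)) -> (forall y, D2 y -> D1 (v y)) ->
  (forall x, x \in V1 -> u x \in V2) -> (forall y, y \in V2 -> v y \in V1) ->
  (forall x, D1 x -> v (u x) - a *: x \in V1) ->
  (forall y, D2 y -> u (v y) - a *: y \in V2) ->
  vdim R (subquot D1 V1) = vdim R (subquot D2 V2).
Proof.
move=> a0 uD vD uV vV vu uv.
have uQ q : subquot D1 V1 q -> subquot D2 V2 (lquot_map V2 u q).
  by move=> [x Dx <-]; exists (u x); [exact: uD | rewrite lquot_map_pi].
have vQ q : subquot D2 V2 q -> subquot D1 V1 (lquot_map V1 v q).
  by move=> [x Dx <-]; exists (v x); [exact: vD | rewrite lquot_map_pi].
have vuQ q : subquot D1 V1 q -> lquot_map V1 v (lquot_map V2 u q) = a *: q.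
  move=> [x Dx <-]; rewrite !lquot_map_pi// -linearZ.
  by apply/lquot_piP; exact: vu.
have uvQ q : subquot D2 V2 q -> lquot_map V2 u (lquot_map V1 v q) = a *: q.
  move=> [x Dx <-]; rewrite !lquot_map_pi// -linearZ.
  by apply/lquot_piP; exact: uv.
have uL := @lquot_map_linear _ _ V1 V2 u uV.
have vL := @lquot_map_linear _ _ V2 V1 v vV.
rewrite /vdim; congr (ereal_inf (image _ _)).
apply/seteqP; split=> n [e e_basis]; eexists.
- exact: is_basis_transfer uL vL a0 uQ vQ vuQ uvQ e_basis.
- exact: is_basis_transfer vL uL a0 vQ uQ uvQ vuQ e_basis.
Qed.

Lemma rangepE (Z1 Z2 : lmodType K) (T : {linear Z1 -> Z2}) (y : Z2) :
  y \in rangep T <-> range T y.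
Proof. by split=> [/asboolP|/asboolP]. Qed.

Lemma kerpE (Z1 Z2 : lmodType K) (T : {linear Z1 -> Z2}) (x : Z1) :
  x \in kerp T <-> T x = 0.
Proof. by split=> [/eqP|/eqP]. Qed.

Lemma oppow_intertwine (X Y : lmodType K) (T : {linear X -> X})
    (S : {linear Y -> Y}) (u : X -> Y) (n : nat) (x : X) :
  (forall z, u (T z) = S (u z)) -> u (oppow T n x) = oppow S n (u x).
Proof.
by move=> uT; rewrite /oppow; elim: n => //= n <-; rewrite uT.
Qed.

End Dimension.

(** * Operators that are equivalent up to a factor invertible modulo them *)

(** [fwd] and [bwd] intertwine [T] and [S], and are inverse to each other, up
    to the scalar [scal], modulo multiples of [T] and [S] by commuting
    operators.  Both halves are kept, so that the notion is symmetric. *)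
Record linkage (K : fieldType) (X Y : lmodType K) (T : {linear X -> X})
    (S : {linear Y -> Y}) := Linkage {
  fwd : {linear X -> Y};
  bwd : {linear Y -> X};
  scal : K;
  remX : {linear X -> X};
  remY : {linear Y -> Y};
  scal_neq0 : scal != 0;
  fwdT : forall x, fwd (T x) = S (fwd x);
  bwdS : forall y, bwd (S y) = T (bwd y);
  remXT : forall x, remX (T x) = T (remX x);
  remYS : forall y, remY (S y) = S (remY y);
  bwd_fwd : forall x, bwd (fwd x) = scal *: x + T (remX x);
  fwd_bwd : forall y, fwd (bwd y) = scal *: y + S (remY y) }.

Definition linkage_sym (K : fieldType) (X Y : lmodType K)
    (T : {linear X -> X}) (S : {linear Y -> Y}) (L : linkage T S) :
    linkage S T :=
  Linkage (scal_neq0 L) (bwdS L) (fwdT L) (remYS L) (remXT L) (fwd_bwd L)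
    (bwd_fwd L).

Section LinkageHalf.
Variables (K : fieldType) (X Y : lmodType K) (T : {linear X -> X})
  (S : {linear Y -> Y}) (L : linkage T S).

Lemma fwd_range n x : range (oppow T n) x -> range (oppow S n) (fwd L x).
Proof.
move=> [z _ <-]; exists (fwd L z) => //.
by rewrite (@oppow_intertwine _ _ _ T S)//; exact: fwdT.
Qed.

Lemma fwd_ker n x : oppow T n x = 0 -> oppow S n (fwd L x) = 0.
Proof.
move=> Tx; rewrite -(@oppow_intertwine _ _ _ T S) ?Tx ?linear0//.
exact: fwdT.
Qed.

(** [T] composed with [remX L] maps R(T^n) into R(T^(n+1)), because the two
    commute; it is the difference of [bwd] after [fwd] and the scalar. *)
Lemma bwd_fwd_range n x : range (oppow T n) x ->
  range (oppow T n.+1) (bwd L (fwd L x) - scal L *: x).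
Proof.
move=> [z _ <-]; rewrite bwd_fwd addrC addKr; exists (remX L z) => //.
rewrite (@oppow_intertwine _ _ _ T T) //; exact: remXT.
Qed.

(** For the same reason, [T] composed with [remX L] maps N(T^(n+1)) into
    N(T^n). *)
Lemma bwd_fwd_ker n x : oppow T n.+1 x = 0 ->
  oppow T n (bwd L (fwd L x) - scal L *: x) = 0.
Proof.
move=> Tx; rewrite bwd_fwd addrC addKr -remXT.
rewrite -(@oppow_intertwine _ _ _ T T); last exact: remXT.
by rewrite [X in remX L X](_ : _ = 0) ?linear0// -Tx /oppow iterSr.
Qed.

(** [bwd] after [fwd] is invertible modulo [T], hence modulo T^n.  Instead of
    inverting it, climb the ranges: if x = T^m z with m < n, then
    scal x differs from bwd (fwd x), which is in R(T^n), by
    T (remX x) = T^(m+1) (remX z). *)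
Lemma range_bwd_fwd n x :
  range (oppow T n) (bwd L (fwd L x)) -> range (oppow T n) x.
Proof.
move=> [w _ wE]; suff: forall m, (m <= n)%N -> range (oppow T m) x by apply.
elim=> [_|m IHm lt_mn]; first by exists x.
have [z _ zE] := IHm (ltnW lt_mn).
exists ((scal L)^-1 *: (oppow T (n - m.+1) w - remX L z)) => //.
have Tlin c p q : oppow T m.+1 (c *: (p - q)) =
    c *: (oppow T m.+1 p - oppow T m.+1 q) by rewrite linearZ linearB.
rewrite Tlin.
have -> : oppow T m.+1 (oppow T (n - m.+1) w) = oppow T n w.
  by rewrite /oppow -iterD subnKC.
rewrite wE bwd_fwd.
rewrite -[oppow T m.+1 (remX L z)](_ : remX L (oppow T m.+1 z) = _); last first.
  by apply: (@oppow_intertwine _ _ _ T T); exact: remXT.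
rewrite [oppow T m.+1 z](_ : _ = T x); last by rewrite -zE /oppow iterS.
by rewrite remXT addrK scalerA mulVf ?scal_neq0// scale1r.
Qed.

Lemma range_preimage n : range (oppow T n) = fwd L @^-1` range (oppow S n).
Proof.
apply/seteqP; split=> x; first exact: fwd_range.
move=> [z _ zE]; apply: range_bwd_fwd; exists (bwd L z) => //.
rewrite -[fwd L x]zE -(@oppow_intertwine _ _ _ S T)//; exact: bwdS.
Qed.

End LinkageHalf.

(** Here one step suffices: R(T) + N(T^d) contains R(T), and [bwd] after [fwd]
    is a nonzero scalar modulo R(T). *)
Lemma range_plus_ker_preimage (K : fieldType) (X Y : lmodType K)
    (T : {linear X -> X}) (S : {linear Y -> Y}) (L : linkage T S) d :
  [set z | exists x y, [/\ range T x, kerp (oppow T d) y & z = x + y]] =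
  fwd L @^-1`
    [set z | exists x y, [/\ range S x, kerp (oppow S d) y & z = x + y]].
Proof.
apply/seteqP; split=> z [x [y [rx ky zE]]].
- exists (fwd L x), (fwd L y); split; first exact: (@fwd_range _ _ _ _ _ L 1).
  + by apply/kerpE/fwd_ker/kerpE.
  + by rewrite zE linearD.
- have [w _ wE] := @fwd_range _ _ _ _ _ (linkage_sym L) 1 x rx.
  exists (T ((scal L)^-1 *: (w - remX L z))), ((scal L)^-1 *: bwd L y).
  split; first by eexists.
  + apply/kerpE; rewrite linearZ /= (@fwd_ker _ _ _ _ _ (linkage_sym L)).
      exact: scaler0.
    exact/kerpE.
  + rewrite linearZ linearB /= -scalerDr.
    rewrite [T w]wE addrAC -linearD -zE /= bwd_fwd addrK.
    by rewrite scalerA mulVf ?scal_neq0// scale1r.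
Qed.

(** * Invariance of the regularities *)

Section Invariance.
Variables (R : realType) (X Y : completeNormedModType R[i]).
Variables (T : {linear X -> X}) (S : {linear Y -> Y}) (L : linkage T S).
Let L' := linkage_sym L.

Lemma linkage_c n : c_ T n = c_ S n.
Proof.
apply: (@vdim_subquot_eq _ _ _ _ _ _ _ _ (fwd L) (bwd L) _ (scal_neq0 L)).
- exact: fwd_range.
- exact: (fwd_range L').
- by move=> x /rangepE ?; apply/rangepE/fwd_range.
- by move=> x /rangepE ?; apply/rangepE/(fwd_range L').
- by move=> x ?; apply/rangepE/bwd_fwd_range.
- by move=> x ?; apply/rangepE/(bwd_fwd_range L').
Qed.

Lemma linkage_c' n : c'_ T n = c'_ S n.
Proof.
apply: (@vdim_subquot_eq _ _ _ _ _ _ _ _ (fwd L) (bwd L) _ (scal_neq0 L)).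
- by move=> x /kerpE ?; apply/kerpE/fwd_ker.
- by move=> x /kerpE ?; apply/kerpE/(fwd_ker L').
- by move=> x /kerpE ?; apply/kerpE/fwd_ker.
- by move=> x /kerpE ?; apply/kerpE/(fwd_ker L').
- by move=> x /kerpE ?; apply/kerpE/bwd_fwd_ker.
- by move=> x /kerpE ?; apply/kerpE/(bwd_fwd_ker L').
Qed.

(** Describing the kernel of the induced map by representatives puts [k_] in
    the form to which [vdim_subquot_eq] applies. *)
Lemma k_subquot (Z : completeNormedModType R[i]) (Q : {linear Z -> Z}) n :
  k_ Q n = vdim R (subquot
    [set x | range (oppow Q n) x /\ range (oppow Q n.+2) (Q x)]
    (rangep (oppow Q n.+1))).
Proof.
have ind := induced_pi (@rangep_oppowS _ Z Q n.+1).
rewrite /k_; congr vdim; apply/seteqP; split=> q.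
- move=> [[x rx <-]]; rewrite ind -(linear0 (lquot_pi (rangep (oppow Q n.+2)))).
  move=> /lquot_piP; rewrite subr0 => /rangepE rQx.
  by exists x.
- move=> [x [rx rQx] <-]; split; first by exists x.
  rewrite ind -(linear0 (lquot_pi (rangep (oppow Q n.+2)))).
  by apply/lquot_piP; rewrite subr0; apply/rangepE.
Qed.

Lemma linkage_k n : k_ T n = k_ S n.
Proof.
rewrite !k_subquot.
apply: (@vdim_subquot_eq _ _ _ _ _ _ _ _ (fwd L) (bwd L) _ (scal_neq0 L)).
- by move=> x [rx rTx]; split; [|rewrite -fwdT]; exact: fwd_range.
- by move=> x [rx rTx]; split; [|rewrite -bwdS]; exact: (fwd_range L').
- by move=> x /rangepE ?; apply/rangepE/fwd_range.
- by move=> x /rangepE ?; apply/rangepE/(fwd_range L').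
- by move=> x [? _]; apply/rangepE/bwd_fwd_range.
- by move=> x [? _]; apply/rangepE/(bwd_fwd_range L').
Qed.

(** One implication and the continuity of one of the two maps are enough: the
    converse is the same statement for [linkage_sym]. *)
Lemma regularity_linkage i :
  continuous (fwd L) -> regularity i S -> regularity i T.
Proof.
move=> fwd_cont.
have cE : c_ T = c_ S by apply/funext; exact: linkage_c.
have c'E : c'_ T = c'_ S by apply/funext; exact: linkage_c'.
have kE : k_ T = k_ S by apply/funext; exact: linkage_k.
have cl_pow n : closed (range (oppow S n)) -> closed (range (oppow T n)).
  rewrite (range_preimage L); apply: preimage_closed => x _; exact: fwd_cont.
have cl1 : closed (range S) -> closed (range T) := cl_pow 1.
have cl_sum d : range_plus_ker_closed S d -> range_plus_ker_closed T d.
  rewrite /range_plus_ker_closed (range_plus_ker_preimage L).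
  by apply: preimage_closed => x _; exact: fwd_cont.
(* The first twenty values of i are separated; regularity is False beyond. *)
do 20? [case: i => [|i]]; rewrite /= /c_sum /c'_sum /k_sum ?cE ?c'E ?kE.
all: first [ exact: id | by move=> [? ?]; split=> //; apply: cl1
  | by move=> [d [? ?]]; exists d; split=> //; exact: (cl_pow d.+1)
  | by move=> [d [? ?]]; exists d; split=> //; exact: (cl_sum d) ].
Qed.

End Invariance.

(** * The operators of the theorem *)

(** P^4 - l^4 = (P - l)(P^3 + l P^2 + l^2 P + l^3). *)
Lemma pow4_sub_scale (K : fieldType) (Z : lmodType K) (P : {linear Z -> Z})
    (l : K) (x : Z) :
  P (P (P (P x))) = l ^+ 4 *: x + (P \- l \*: idfun)
    (((P \o P \o P) \+ l \*: (P \o P) \+ (l ^+ 2) \*: P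
      \+ (l ^+ 3) \*: idfun) x).
Proof.
rewrite /= !linearD !linearZ /= !scalerA -!exprS -expr2 !scalerN -!opprD.
set a := P (P (P (P x))).
by rewrite -(addrA a) -(addrA a) addrKA addrC subrK.
Qed.

(** When [X] is zero the bound [M] can be any scalar, not comparable with the
    positive reals; its norm is a bound that always is. *)
Lemma bounded_operator_continuous (K : numFieldType) (X Y : normedModType K)
    (f : {linear X -> Y}) : bounded_operator f -> continuous f.
Proof.
move=> [M fM]; apply/linear_bounded_continuous/linear_boundedP.
near=> r => x; have Mx := le_trans (normr_ge0 _) (fM x).
apply: le_trans (fM x) _.
rewrite -[M * _]ger0_norm// normrM normr_id ler_wpM2r//.
Unshelve. all: by end_near.
Qed.

Section Products.
Variables (K : numFieldType) (X Y : normedModType K).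
Variables (A : {linear X -> Y}) (B C : {linear Y -> X}).
Hypotheses (A_bnd : bounded_operator A) (B_bnd : bounded_operator B)
  (C_bnd : bounded_operator C).
Hypotheses
  (h1 : A \o (B \o A) \o (B \o A) =1 A \o B \o A \o C \o A)
  (h2 : A \o B \o A \o C \o A =1 A \o C \o A \o B \o A)
  (h3 : A \o C \o A \o B \o A =1 (A \o C) \o (A \o C) \o A).

(** The intertwiners are found by lengthening A and BAC until the
    hypothesis applies: A itself satisfies QA = AP only up to the kernel
    of Q, but QABA = ACABA = ABABA = ABAP; similarly BAC satisfies PBAC = BACQ
    only after applying A, and multiplying on the right by Q gives
    P(BACAC) = (BACAC)Q. *)
Lemma linkage_products (l : K) : l != 0 ->
  exists L : linkage ((B \o A) \- l \*: idfun) ((A \o C) \- l \*: idfun),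
    continuous (fwd L) /\ continuous (bwd L).
Proof.
move=> l0.
have e1 x : A (B (A (B (A x)))) = A (B (A (C (A x)))) := h1 x.
have e2 x : A (B (A (C (A x)))) = A (C (A (B (A x)))) := h2 x.
have e3 x : A (C (A (B (A x)))) = A (C (A (C (A x)))) := h3 x.
pose u : {linear X -> Y} := A \o B \o A.
pose v : {linear Y -> X} := B \o A \o C \o A \o C.
pose g (Z : normedModType K) (P : {linear Z -> Z}) : {linear Z -> Z} :=
  (P \o P \o P) \+ l \*: (P \o P) \+ (l ^+ 2) \*: P
    \+ (l ^+ 3) \*: idfun.
have gT (Z : normedModType K) (P : {linear Z -> Z}) x :
    g Z P ((P \- l \*: idfun) x) = (P \- l \*: idfun) (g Z P x).
  have gP y : g Z P (P y) = P (g Z P y) by rewrite /= !linearD !linearZ.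
  by rewrite /= -[LHS]/(g Z P (P x - l *: x)) linearB linearZ /= -gP.
have uT x : u (((B \o A) \- l \*: idfun) x) =
    ((A \o C) \- l \*: idfun) (u x).
  by rewrite /= !linearB !linearZ /= e1 e2.
have vS y : v (((A \o C) \- l \*: idfun) y) =
    ((B \o A) \- l \*: idfun) (v y).
  by rewrite /= !linearB !linearZ /= -e3 -e2.
have vu x : v (u x) = l ^+ 4 *: x +
    ((B \o A) \- l \*: idfun) (g X (B \o A) x).
  by rewrite -pow4_sub_scale /= -e3 -e2 -e1.
have uv y : u (v y) = l ^+ 4 *: y +
    ((A \o C) \- l \*: idfun) (g Y (A \o C) y).
  by rewrite -pow4_sub_scale /= e1 e2 e3.
have l40 : l ^+ 4 != 0 by rewrite expf_neq0.
have cont_comp (U V W : normedModType K) (p : U -> V) (q : V -> W) :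
    continuous p -> continuous q -> continuous (q \o p).
  by move=> pc qc x; apply: continuous_comp; [exact: pc|exact: qc].
have Ac := bounded_operator_continuous A_bnd.
have Bc := bounded_operator_continuous B_bnd.
have Cc := bounded_operator_continuous C_bnd.
exists (Linkage l40 uT vS (gT _ _) (gT _ _) vu uv); split.
- exact: (cont_comp _ _ _ _ _ Ac (cont_comp _ _ _ _ _ Bc Ac)).
- exact: (cont_comp _ _ _ _ _ Cc (cont_comp _ _ _ _ _ Ac
    (cont_comp _ _ _ _ _ Cc (cont_comp _ _ _ _ _ Ac Bc)))).
Qed.

End Products.

Unset Implicit Arguments.
Set Strict Implicit.

Theorem theorem3p1 (R : realType) (X Y : completeNormedModType R[i])
    (A : {linear X -> Y}) (B C : {linear Y -> X})
    (hA : bounded_operator A) (hB : bounded_operator B)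
    (hC : bounded_operator C)
    (h1 : A \o (B \o A) \o (B \o A) =1 A \o B \o A \o C \o A)
    (h2 : A \o B \o A \o C \o A =1 A \o C \o A \o B \o A)
    (h3 : A \o C \o A \o B \o A =1 (A \o C) \o (A \o C) \o A)
    (i : nat) (hi : (1 <= i <= 19)%N) :
  spectrum i (A \o C) `\ 0 = spectrum i (B \o A) `\ 0.
Proof.
apply/seteqP; split=> l [nreg /eqP l0]; split=> [reg|]; try exact/eqP.
all: have [L [fwd_cont bwd_cont]] := linkage_products hA hB hC h1 h2 h3 l0.
all: apply: nreg.
- exact: (regularity_linkage (L := linkage_sym L)).
- exact: (regularity_linkage (L := L)).
Qed.
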